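(* Let $\mu_X$ be a compactly supported probability measure on $\mathbb{R}$ and let $b$ be the supremum of its support. Assume that $\mu_X$ has a density $f_{\mu_X}$ with a power decay at $b$, i.e. that, as $t\to b$ with $t<b$, $f_{\mu_X}(t)\sim c\,(b-t)^\alpha$ for some exponent $\alpha>-1$ and some constant $c>0$. Then $$G_{\mu_X}(b^+)<\infty\iff\alpha>0\qquad\text{and}\qquad G_{\mu_X}'(b^+)=-\infty\iff\alpha\le1.$$ In particular, if $\alpha=1/2$, then $G_{\mu_X}(b^+)<\infty$ and $G_{\mu_X}'(b^+)=-\infty$.
   Context: $G_{\mu_X}(z)=\int\frac{1}{z-t}\,d\mu_X(t)$ for $z\notin\operatorname{supp}\mu_X$ is the Cauchy transform of $\mu_X$. For a function $f$ and $c\in\mathbb{R}$, $f(c^+)=\lim_{z\downarrow c}f(z)$. The notation $f(t)\sim g(t)$ means $f(t)/g(t)\to1$. *)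

(* Defs.v *)
From HB Require Import structures.
From mathcomp Require Import all_boot all_order all_algebra.
From mathcomp Require Import all_classical all_reals all_analysis.
Set Implicit Arguments.
Unset Strict Implicit.
Unset Printing Implicit Defensive.
Import Order.TTheory GRing.Theory Num.Theory.
Import numFieldNormedType.Exports.
Local Open Scope classical_set_scope.
Local Open Scope ring_scope.

Definition measure_support (R : realType)
    (mu : {measure set (measurableTypeR R) -> \bar R}) : set R :=
  [set x | forall U : set R, open U -> U x -> (0 < mu U)%E].

Definition is_density (R : realType)
    (mu : {measure set (measurableTypeR R) -> \bar R}) (f : R -> R) : Prop :=
  [/\ measurable_fun [set: R] f,
      forall t, 0 <= f t &
      forall A : set (measurableTypeR R), measurable A ->
        mu A = (\int[@lebesgue_measure R]_(t in A) (f t)%:E)%E].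

(* Restricted to real arguments; meaningful for z outside the support of mu,
   and possibly a default value of the real-valued integral elsewhere. *)
Definition cauchy_transform (R : realType)
    (mu : {measure set (measurableTypeR R) -> \bar R}) (z : R) : R :=
  \int[mu]_(t in [set: R]) (z - t)^-1.

(* f(c^+), computed in the extended reals so that it may be infinite. *)
Definition right_lim (R : realType) (f : R -> R) (c : R) : \bar R :=
  lim ((f z)%:E @[z --> c^'+]).

Definition has_right_lim (R : realType) (f : R -> R) (c : R) : Prop :=
  cvg ((f z)%:E @[z --> c^'+]).

(* f(t) ~ g(t), in the sense f(t) / g(t) -> 1, as t -> b with t < b. *)
Definition equiv_at_left (R : realType) (b : R) (f g : R -> R) : Prop :=
  f t / g t @[t --> b^'-] --> (1 : R).

(* Main.v *)
Require Import Defs.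
From HB Require Import structures.
From mathcomp Require Import all_boot all_order all_algebra.
From mathcomp Require Import all_classical all_reals all_analysis.
From mathcomp Require Import measurable_realfun ring lra.
Set Implicit Arguments.
Unset Strict Implicit.
Unset Printing Implicit Defensive.
Import Order.TTheory GRing.Theory Num.Theory.
Import numFieldNormedType.Exports.
Local Open Scope classical_set_scope.
Local Open Scope ring_scope.

(** Let mu be carried by ]-oo, b[ and, for k = 1, 2, let J_k(z) be the integral
    over ]-oo, b[ of (z - t)^-k against mu ([inv_moment]).  To the right of b,
    G = J_1 and, by differentiation under the integral sign, G' = - J_2.  As z
    decreases to b the integrands increase to (b - t)^-k, so monotone
    convergence gives the right limits J_1(b) and - J_2(b), finite or not
    ([cvg_inv_moment]).  Everything is thus reduced to the finiteness of the two
    numbers J_k(b).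

    That finiteness depends only on the mass which mu puts on the dyadic shells
    [b - r, b - r/2[.  Since f(t) ~ c (b - t)^alpha, this mass is comparable to
    r^(alpha + 1) for small r ([density_power_shell]); as (b - t)^-k is
    comparable to r^-k on the shell, the shell contributes about
    r^(alpha + 1 - k) to J_k(b).  Along r = d / 2^n these contributions form a
    geometric progression of ratio 2^-(alpha + 1 - k), whose sum is finite if
    and only if k < alpha + 1 ([inv_moment_lty]): alpha > 0 for k = 1 and
    alpha > 1 for k = 2.  Working with shells needs only the masses of
    intervals, neither integrals of power functions nor a change of measure
    from mu to its density, and treats all signs of alpha alike.

    That mu is carried by ]-oo, b[ holds because the complement of the support
    is negligible ([measure_support_setC]) and because a measure with a density
    has no atom at b. *)

(** * Measures carried by a left half-line *)

(** Every point off the support lies in a null ball of rational centre and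
    radius, and there are countably many of these. *)
Lemma measure_support_setC (R : realType)
    (mu : {measure set (measurableTypeR R) -> \bar R}) :
  mu.-negligible (~` measure_support mu).
Proof.
pose F n : set (measurableTypeR R) :=
  if unpickle n is Some (c, r) then
    let B := ball (@ratr R c) (ratr r) in if mu B == 0%E then B else set0
  else set0.
apply: (@negligibleS _ _ _ mu (\bigcup_n F n)).
  move=> x /existsNP[U /not_implyP[oU /not_implyP[Ux /negP]]].
  rewrite -leNgt => U0.
  have [c [r /= [/set_mem Bx BU]]] := open_subball_rat oU (mem_set Ux).
  exists (pickle (c, r)); first exact: I.
  rewrite /F pickleK; rewrite ifT; first exact: Bx.
  rewrite eq_le measure_ge0 andbT (le_trans _ U0) // le_measure ?inE //.
    exact: measurable_ball.
  exact: open_measurable.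
apply: negligible_bigcup => n; rewrite /F.
case: unpickle => [[c r]|]; last exact: negligible_set0.
case: ifPn => [/eqP B0|_]; last exact: negligible_set0.
by apply/negligibleP => //; exact: measurable_ball.
Qed.

Lemma measure_ge_sup_support (R : realType)
    (mu : {measure set (measurableTypeR R) -> \bar R}) (b : R) :
    compact (measure_support mu) -> b = sup (measure_support mu) ->
    mu [set b] = 0%E ->
  mu `[b, +oo[%classic = 0%E.
Proof.
move=> cS bS mub0; apply: measure_negligible => //.
apply: (@negligibleS _ _ _ mu ([set b] `|` ~` measure_support mu)); last first.
  apply: negligibleU; last exact: measure_support_setC.
  exact/negligibleP.
move=> x /=; rewrite in_itv /= andbT le_eqVlt => /orP[/eqP <-|bx]; first by left.
right=> Sx; move: bx; rewrite ltNge bS => /negP; apply.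
apply: ub_le_sup => //.
have [M [_ MS]] := compact_bounded cS.
exists (M + 1) => y Sy; apply: le_trans (ler_norm y) _.
by apply: MS => //; rewrite ltrDl.
Qed.

Lemma density_measure_set1 (R : realType)
    (mu : {measure set (measurableTypeR R) -> \bar R}) (f : R -> R) (b : R) :
  is_density mu f -> mu [set b] = 0%E.
Proof.
move=> [mf f0 muf]; rewrite muf //; apply: null_set_integral => //.
  by apply/measurable_EFinP; exact: measurable_funTS.
exact: lebesgue_measure_set1.
Qed.

(** * Moments of inverse distances and the Cauchy transform *)

Lemma ler_invX (R : realFieldType) (x y : R) (k : nat) :
  0 < x -> x <= y -> y^-1 ^+ k <= x^-1 ^+ k.
Proof.
move=> x0 xy; have y0 : 0 < y by exact: lt_le_trans xy.
apply: lerXn2r; rewrite ?nnegrE ?invr_ge0; [exact: ltW|exact: ltW|].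
by rewrite lef_pV2.
Qed.

(** Inversion is continuous on the complement of the closed set {0}, and every
    function is measurable on a single point. *)
Lemma measurable_funV (R : realType) :
  measurable_fun [set: R] (fun x : R => x^-1).
Proof.
rewrite -(setvU [set (0 : R)]); apply/measurable_funU => //.
  exact: measurableC.
split; last exact: measurable_fun_set1.
apply: open_continuous_measurable_fun.
  exact/closed_openC/accessible_closed_set1/hausdorff_accessible/Rhausdorff.
by move=> x; rewrite inE => /eqP x0; exact: inv_continuous.
Qed.

Lemma measurable_inv_sub_exp (R : realType) (z : R) (k : nat)
    (D : set R) :
  measurable_fun D (fun t : R => (z - t)^-1 ^+ k).
Proof.
apply: measurable_funTS; apply: measurable_funX.
by apply: (measurableT_comp (@measurable_funV R)); exact: measurable_funB.
Qed.

Lemma measurable_EFin_inv_sub_exp (R : realType) (z : R) (k : nat)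
    (D : set (measurableTypeR R)) :
  measurable_fun D (fun t : measurableTypeR R => ((z - t)^-1 ^+ k)%:E).
Proof. apply/measurable_EFinP; exact: measurable_inv_sub_exp. Qed.

(** Extended-real valued, because at the endpoint z = b the value +oo is the
    very phenomenon under study. *)
Definition inv_moment (R : realType)
    (mu : {measure set (measurableTypeR R) -> \bar R}) (b : R) (k : nat) (z : R)
    : \bar R :=
  (\int[mu]_(t in `]-oo, b[) ((z - t)^-1 ^+ k)%:E)%E.

Lemma integrable_inv_sub_exp (R : realType)
    (mu : probability (measurableTypeR R) R) (b z : R) (k : nat) :
  b < z ->
  mu.-integrable `]-oo, b[ (EFin \o (fun t : R => (z - t)^-1 ^+ k)).
Proof.
move=> bz; apply: measurable_bounded_integrable => //.
- by rewrite ltey_eq fin_num_measure.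
- exact: measurable_inv_sub_exp.
exists ((z - b)^-1 ^+ k); split; first exact: num_real.
move=> M MM t /=; rewrite in_itv /= => tb; apply: le_trans (ltW MM).
have zb0 : 0 < z - b by rewrite subr_gt0.
have zt0 : z - b <= z - t by rewrite lerD2l lerN2 ltW.
have zt1 : 0 < z - t by exact: lt_le_trans zt0.
rewrite ger0_norm; last by rewrite exprn_ge0 // invr_ge0 ltW.
exact: ler_invX.
Qed.

(** The integrands over the line and, extended by 0, over ]-oo, b[ are
    measurable and agree almost everywhere; this gives the equality for every
    real z. *)
Lemma cauchy_transform_lt (R : realType)
    (mu : {measure set (measurableTypeR R) -> \bar R}) (b z : R) :
  mu `[b, +oo[%classic = 0%E ->
  cauchy_transform mu z = \int[mu]_(t in `]-oo, b[) (z - t)^-1.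
Proof.
move=> mub; congr fine; rewrite [RHS]integral_mkcond.
have mf (D : set (measurableTypeR R)) :
    measurable_fun D (fun t : measurableTypeR R => ((z - t)^-1)%:E).
  exact: (measurable_EFin_inv_sub_exp z 1).
apply: ae_eq_integral => //.
  by apply/(measurable_restrictT _ _).1 => //; exact: mf.
exists `[b, +oo[%classic; split => // t /= tE; rewrite in_itv /= andbT leNgt.
apply/negP => tb; apply: tE => _; rewrite patchE ifT //.
by rewrite inE /= in_itv.
Qed.

Lemma is_derive_inv_sub (R : realType) (t z : R) :
  t < z -> is_derive z 1 (fun z : R => (z - t)^-1) (- (z - t)^-1 ^+ 2).
Proof.
move=> tz; have zt : z - t != 0 by rewrite subr_eq0 gt_eqF.
have D : is_derive z 1 (fun z : R => z - t) (1 - 0) by exact: is_deriveB.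
apply: is_derive_eq (@is_deriveV _ (fun z => z - t) z _ 1 zt D) _.
by rewrite subr0 /GRing.scale /= mulr1 exprVn.
Qed.

(** On a neighbourhood of z bounded away from b by u, the integrand and its
    derivative in z are bounded uniformly in t, and mu is finite: this is the
    domination needed to differentiate under the integral sign. *)
Lemma is_derive_integral_inv_sub (R : realType)
    (mu : probability (measurableTypeR R) R) (b z : R) : b < z ->
  is_derive z 1 (fun z => \int[mu]_(t in `]-oo, b[) (z - t)^-1)
    (- \int[mu]_(t in `]-oo, b[) (z - t)^-1 ^+ 2).
Proof.
move=> bz; pose u := (b + z) / 2.
have bu : b < u by rewrite /u; lra.
have uz : u < z by rewrite /u; lra.
have zI : `]u, (z + 1)[%classic z by rewrite /= in_itv /= uz ltrDl ltr01.
have Ib x : `]u, (z + 1)[%classic x -> b < x.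
  by rewrite /= in_itv /= => /andP[ux _]; exact: lt_trans ux.
have dI x y : `]u, (z + 1)[%classic x -> `]-oo, b[%classic y ->
    is_derive x 1 (fun z : R => (z - y)^-1) (- (x - y)^-1 ^+ 2).
  move=> /Ib bx; rewrite /= in_itv /= => yb.
  by apply: is_derive_inv_sub; exact: lt_trans bx.
have mD : measurable (`]-oo, b[%classic : set (measurableTypeR R)) by [].
have iI x : `]u, (z + 1)[%classic x ->
    mu.-integrable `]-oo, b[ (EFin \o (fun y : R => (x - y)^-1)).
  by move=> /Ib bx; exact: (integrable_inv_sub_exp mu 1 bx).
have ddI x y : `]u, (z + 1)[%classic x -> `]-oo, b[%classic y ->
    derivable (fun z : R => (z - y)^-1) x 1.
  by move=> Ix Dy; case: (dI _ _ Ix Dy).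
have d1 x y : `]u, (z + 1)[%classic x -> `]-oo, b[%classic y ->
    partial1of2 (fun z t : R => (z - t)^-1) x y = - (x - y)^-1 ^+ 2.
  by move=> Ix Dy; rewrite partial1of2E; case: (dI _ _ Ix Dy).
pose g (y : R) := (u - b)^-1 ^+ 2.
have g0 y : 0 <= g y by rewrite sqr_ge0.
have ig : mu.-integrable `]-oo, b[ (EFin \o g).
  exact: finite_measure_integrable_cst.
have gub x y : `]u, (z + 1)[%classic x -> `]-oo, b[%classic y ->
    `|partial1of2 (fun z t : R => (z - t)^-1) x y| <= g y.
  move=> Ix Dy; rewrite d1 // normrN ger0_norm ?sqr_ge0 //.
  move: Ix Dy; rewrite /= !in_itv /= => /andP[ux _] yb.
  have uy : u - b <= x - y by lra.
  have ub0 : 0 < u - b by rewrite subr_gt0.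
  have xy0 : 0 < x - y by exact: lt_le_trans uy.
  exact: ler_invX.
apply: DeriveDef.
  exact: (derivable_under_integral mD zI iI ddI g0 ig gub).
rewrite -derive1E (differentiation_under_integral mD zI iI ddI g0 ig gub).
rewrite -mulN1r -RintegralZl //; last exact: (integrable_inv_sub_exp mu 2 bz).
by apply: eq_Rintegral => t; rewrite inE => Dt; rewrite d1 // mulN1r.
Qed.

Lemma is_derive_cauchy_transform (R : realType)
    (mu : probability (measurableTypeR R) R) (b z : R) :
  mu `[b, +oo[%classic = 0%E -> b < z ->
  is_derive z 1 (cauchy_transform mu)
    (- \int[mu]_(t in `]-oo, b[) (z - t)^-1 ^+ 2).
Proof.
move=> mub /(is_derive_integral_inv_sub mu).
by congr is_derive; apply/funext => x; rewrite (cauchy_transform_lt _ mub).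
Qed.

Lemma EFin_Rintegral_inv_sub_exp (R : realType)
    (mu : probability (measurableTypeR R) R) (b z : R) (k : nat) : b < z ->
  (\int[mu]_(t in `]-oo, b[) (z - t)^-1 ^+ k)%:E = inv_moment mu b k z.
Proof.
move=> bz; rewrite /inv_moment /Rintegral fineK //.
exact: integrable_fin_num (integrable_inv_sub_exp mu k bz).
Qed.

(** * Right limits at the edge *)

Lemma cvg_harmonic_at_right (R : realType) (b : R) :
  (b + harmonic n)%R @[n --> \oo] --> b^'+.
Proof.
have ub : (b + harmonic n)%R @[n --> \oo] --> b.
  rewrite -[X in _ --> X]addr0; apply: cvgD; first exact: cvg_cst.
  exact: cvg_harmonic.
move=> A [e /= e0 eA].
move/cvgrPdist_lt : ub => /(_ _ e0); apply: filterS => n nb.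
by apply: eA => //=; rewrite ltrDl harmonic_gt0.
Qed.

Lemma inv_sub_exp_ge0 (R : realType) (b z t : R) (k : nat) :
  b <= z -> t < b -> 0 <= (z - t)^-1 ^+ k.
Proof.
by move=> bz tb; rewrite exprn_ge0 // invr_ge0 subr_ge0 ltW // (lt_le_trans tb).
Qed.

(** J k is nonincreasing to the right of b, so it has a limit there in the
    extended reals; monotone convergence along b + 1/(n + 1) identifies it. *)
Lemma cvg_inv_moment (R : realType)
    (mu : {measure set (measurableTypeR R) -> \bar R}) (b : R) (k : nat) :
  inv_moment mu b k z @[z --> b^'+] --> inv_moment mu b k b.
Proof.
set J := inv_moment mu b k.
have mJ z (D : set (measurableTypeR R)) :
    measurable_fun D (fun t : measurableTypeR R => ((z - t)^-1 ^+ k)%:E).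
  exact: measurable_EFin_inv_sub_exp.
have Jni : {in Interval (BRight b) (BInfty R false) &,
    {homo J : x y / x <= y >-> (y <= x)%E}}.
  move=> x y; rewrite !in_itv /= !andbT => bx bY xy.
  apply: ge0_le_integral => //.
  - move=> t; rewrite /= in_itv /= lee_fin => tb.
    exact: inv_sub_exp_ge0 (ltW bY) tb.
  move=> t; rewrite /= in_itv /= lee_fin => tb.
  by apply: ler_invX; rewrite ?subr_gt0 ?lerD2r // (lt_trans tb).
have Jsup := nonincreasing_at_right_cvge (BInfty R false) isT Jni.
pose u n : R := b + harmonic n.
have bu n : b < u n by rewrite ltrDl harmonic_gt0.
have und m n : (m <= n)%N -> u n <= u m.
  by move=> mn; rewrite lerD2l /harmonic lef_pV2 ?posrE ?ltr0n // ler_nat.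
have Jusup := cvg_comp _ _ (@cvg_harmonic_at_right R b) Jsup.
have : J (u n) @[n --> \oo] --> J b.
  have -> : J b = (\int[mu]_(t in `]-oo, b[)
      limn (fun n => ((u n - t)^-1 ^+ k)%:E))%E.
    apply: eq_integral => t; rewrite inE /= in_itv /= => tb.
    apply/esym/cvg_lim => //; apply: cvg_EFin; first exact: nearW.
    have cu : u n @[n --> \oo] --> b.
      by apply: (cvg_trans (@cvg_harmonic_at_right R b)); exact: cvg_within.
    have C : {for b, continuous (fun x => (x - t)^-1 ^+ k)}.
      apply: (@continuous_comp _ _ _ (fun x => (x - t)^-1) (fun y => y ^+ k)).
        apply: continuousV; first by rewrite subr_eq0 gt_eqF.
        by apply: continuousB; [exact: cvg_id|exact: cvg_cst].
      exact: exprn_continuous.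
    exact: (cvg_comp _ _ cu C).
  apply: cvg_monotone_convergence => //.
  - move=> n t; rewrite /= in_itv /= lee_fin => tb.
    exact: inv_sub_exp_ge0 (ltW (bu n)) tb.
  - move=> t; rewrite /= in_itv /= => tb m n mn; rewrite lee_fin.
    by apply: ler_invX; rewrite ?subr_gt0 ?lerD2r ?und // (lt_trans tb).
by move=> /(cvg_unique _ Jusup) <-.
Qed.

Lemma cvg_at_right_eq (R : realType) (b : R) (f : R -> R) (J : R -> \bar R)
    (l : \bar R) :
    (forall z, b < z -> (f z)%:E = J z) -> J z @[z --> b^'+] --> l ->
  (f z)%:E @[z --> b^'+] --> l.
Proof.
move=> fJ; apply: cvg_trans; apply: near_eq_cvg; near=> z.
by rewrite fJ //; near: z; exact: nbhs_right_gt.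
Unshelve. all: by end_near. Qed.

(** * Mass of the dyadic shells below the edge *)

(** Two points within a factor 2 of each other have comparable powers, with a
    constant valid for both signs of the exponent and symmetric in x and y. *)
Lemma powR_le_two_mul (R : realType) (a x y : R) :
  0 < x -> 0 < y -> x <= 2 * y -> y <= 2 * x -> x `^ a <= 2 `^ `|a| * y `^ a.
Proof.
have pos (u v e : R) : 0 <= e -> 0 < u -> 0 < v -> u <= 2 * v ->
    u `^ e <= 2 `^ e * v `^ e.
  move=> e0 u0 v0 uv; rewrite -powRM //; last exact: ltW.
  by apply: ge0_ler_powR; rewrite ?nnegrE ?mulr_ge0 // ltW.
move=> x0 y0 xy yx; have [a0|a0] := leP 0 a; first by rewrite ger0_norm // pos.
(* For a negative exponent, compare the inverses and swap x and y. *)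
have na0 : 0 <= - a by rewrite oppr_ge0 ltW.
rewrite ltr0_norm // -(opprK a) !(powRN _ (- a)) opprK.
have := pos _ _ _ na0 y0 x0 yx.
move: (powR_gt0 (- a) x0) (powR_gt0 (- a) y0) (powR_gt0 (- a) (ltr0Sn R 1)).
move: (2 `^ - a) (x `^ - a) (y `^ - a) => p q r q0 r0 p0 rpq.
by rewrite ler_pdivlMr // mulrC ler_pdivrMr.
Qed.

Lemma equiv_at_left_itv (R : realType) (b : R) (f g : R -> R) :
    equiv_at_left b f g -> (forall t, t < b -> 0 < g t) ->
  exists2 d : R, 0 < d & forall t, b - d <= t < b -> g t / 2 <= f t <= 2 * g t.
Proof.
move=> /cvgrPdist_lt /(_ (2^-1)) fg g0.
have [|e /= e0 eP] := fg; first by rewrite invr_gt0.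
(* Halving e keeps the closed endpoint b - d inside the open ball. *)
exists (e / 2); first by rewrite divr_gt0.
move=> t /andP[dt tb]; have {eP} : `|1 - f t / g t| < 2^-1.
  by apply: eP => //=; rewrite gtr0_norm ?subr_gt0 //; lra.
have gt0 := g0 _ tb; have fE : f t = f t / g t * g t by rewrite divfK ?gt_eqF.
rewrite {2 3}fE; move: (f t / g t) (g t) gt0 => r s s0.
by rewrite ltr_norml => /andP[r1 r2]; apply/andP; split; nra.
Qed.

Lemma measure_density_itv (R : realType)
    (mu : {measure set (measurableTypeR R) -> \bar R}) (f : R -> R)
    (x y m M : R) :
    is_density mu f -> x <= y -> (forall t, x <= t < y -> m <= f t <= M) ->
    0 <= m ->
  ((m * (y - x))%:E <= mu `[x, y[%classic <= (M * (y - x))%:E)%E.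
Proof.
move=> [mf f0 muf] xy fmM m0; rewrite muf //.
have cstE (k : R) : (k * (y - x))%:E =
    (\int[@lebesgue_measure R]_(t in `[x, y[) (cst k%:E) t)%E.
  rewrite integral_cst //= lebesgue_measure_itv /= lte_fin.
  move: xy; rewrite le_eqVlt => /orP[/eqP ->|->].
    by rewrite ltxx subrr mulr0 mule0.
  by rewrite -EFinB -EFinM.
have mef : measurable_fun `[x, y[ (fun t => (f t)%:E).
  by apply/measurable_EFinP; exact: measurable_funTS.
rewrite !cstE; apply/andP; split; apply: ge0_le_integral => //.
- by move=> t; rewrite /= in_itv /= lee_fin => /fmM /andP[].
- by move=> t _; rewrite lee_fin.
- by move=> t; rewrite /= in_itv /= lee_fin => /fmM /andP[].
Qed.

(** On the shell, b - t lies within a factor 2 of r, so the density is within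
    constant factors of r^a; the shell has length r/2. *)
Lemma density_power_shell (R : realType)
    (mu : {measure set (measurableTypeR R) -> \bar R}) (f : R -> R)
    (b c a : R) :
    is_density mu f -> 0 < c ->
    equiv_at_left b f (fun t => c * (b - t) `^ a) ->
  exists d C1 C2 : R, [/\ 0 < d, 0 < C1, 0 < C2 &
    forall r, 0 < r <= d -> ((C1 * r `^ (a + 1))%:E
      <= mu `[(b - r)%R, (b - r / 2)%R[%classic <= (C2 * r `^ (a + 1))%:E)%E].
Proof.
move=> muf c0 fg.
have [|d d0 dP] := equiv_at_left_itv fg.
  by move=> t tb; rewrite mulr_gt0 // powR_gt0 // subr_gt0.
pose p : R := 2 `^ `|a|; have p0 : 0 < p by exact: powR_gt0.
(* The density lies between c r^a / (2 p) and 2 c p r^a on the shell; the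
   length r / 2 turns these into the two constants. *)
exists d, (c / (4 * p)), (c * p); split => //.
- by rewrite divr_gt0 // mulr_gt0.
- exact: mulr_gt0.
move=> r /andP[r0 rd].
have q0 : 0 < r `^ a by exact: powR_gt0.
have rE : r `^ (a + 1) = r `^ a * r.
  by rewrite powRD; [rewrite powRr1 // ltW|rewrite (gt_eqF r0) implybT].
have lE : b - r / 2 - (b - r) = r / 2 by lra.
have /= := @measure_density_itv _ mu f (b - r) (b - r / 2)
  (c / (2 * p) * r `^ a) (2 * c * p * r `^ a) muf.
rewrite lE rE.
have -> : c / (2 * p) * r `^ a * (r / 2) = c / (4 * p) * (r `^ a * r).
  by field; rewrite gt_eqF.
have -> : 2 * c * p * r `^ a * (r / 2) = c * p * (r `^ a * r) by field.
apply; first by lra.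
- move=> t /andP[tl tr].
  have s0 : 0 < b - t by lra.
  have /andP[f1 f2] : c * (b - t) `^ a / 2 <= f t <= 2 * (c * (b - t) `^ a).
    by apply: dP; apply/andP; split; lra.
  have u1 : (b - t) `^ a <= p * r `^ a by apply: powR_le_two_mul => //; lra.
  have u2 : r `^ a <= p * (b - t) `^ a by apply: powR_le_two_mul => //; lra.
  apply/andP; split.
    apply: le_trans f1.
    have -> : c / (2 * p) * r `^ a = c * (r `^ a / p) / 2.
      by field; rewrite gt_eqF.
    by rewrite ler_pM2r ?invr_gt0 // ler_pM2l // ler_pdivrMr // mulrC.
  by apply: (le_trans f2); rewrite -!mulrA ler_pM2l // ler_pM2l.
- apply: mulr_ge0; last exact: powR_ge0.
  by apply: divr_ge0; [exact: ltW|rewrite mulr_ge0 // ltW].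
Qed.

(** * Finiteness of the moments at the edge *)

Lemma powR_halving (R : realType) (d a : R) (n : nat) :
  0 < d -> (d / 2 ^+ n) `^ a = d `^ a * (2^-1 `^ a) ^+ n.
Proof.
move=> d0; rewrite powRM ?invr_ge0 ?exprn_ge0 // ?ltW //; congr (_ * _).
have h0 : 0 <= 2^-1 :> R by rewrite invr_ge0.
by rewrite -exprVn -(powR_mulrn n h0) -(powR_mulrn n (powR_ge0 _ _)) powRAC.
Qed.

(** On the shell r/2 < b - t <= r, which bounds the integrand by constants. *)
Lemma shell_inv_moment (R : realType)
    (mu : {measure set (measurableTypeR R) -> \bar R}) (b r : R) (k : nat)
    (m M : \bar R) : 0 < r ->
    (m <= mu `[(b - r)%R, (b - r / 2)%R[%classic <= M)%E ->
  ((r^-1 ^+ k)%:E * m <=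
    \int[mu]_(t in `[(b - r)%R, (b - r / 2)%R[) ((b - t)^-1 ^+ k)%:E
    <= ((r / 2)^-1 ^+ k)%:E * M)%E.
Proof.
move=> r0 /andP[lm Mu].
pose D : set (measurableTypeR R) := `[(b - r)%R, (b - r / 2)%R[%classic.
have mD : measurable D by exact: measurable_itv.
have mJ : measurable_fun D (fun t : measurableTypeR R => ((b - t)^-1 ^+ k)%:E).
  exact: measurable_EFin_inv_sub_exp.
apply/andP; split.
  apply: (@le_trans _ _ ((r^-1 ^+ k)%:E * mu D)%E).
    by apply: lee_wpmul2l => //; rewrite lee_fin exprn_ge0 // invr_ge0 ltW.
  rewrite -integral_cst //; apply: ge0_le_integral => //.
  - by move=> t _; rewrite lee_fin exprn_ge0 // invr_ge0 ltW.
  move=> t; rewrite /D /= in_itv /= lee_fin => /andP[t1 t2].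
  by apply: ler_invX; lra.
apply: (@le_trans _ _ (((r / 2)^-1 ^+ k)%:E * mu D)%E).
  rewrite -integral_cst //; apply: ge0_le_integral => //.
  - move=> t; rewrite /D /= in_itv /= lee_fin => /andP[t1 t2].
    by rewrite exprn_ge0 // invr_ge0; lra.
  move=> t; rewrite /D /= in_itv /= lee_fin => /andP[t1 t2].
  by apply: ler_invX; lra.
apply: lee_wpmul2l => //.
by rewrite lee_fin exprn_ge0 // invr_ge0 divr_ge0 // ltW.
Qed.

(** The partial integrals I_ n over ]-oo, b - d / 2^n[ grow at step n by a
    shell contribution comparable to q^n with q = 2^-(a - k).  If a <= k then
    q >= 1 and they grow at least linearly; if k < a then q < 1 and a geometric
    series bounds them. *)
Lemma inv_moment_lty (R : realType)
    (mu : probability (measurableTypeR R) R) (b a d C1 C2 : R) (k : nat) :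
    0 < d -> 0 < C1 -> 0 < C2 ->
    (forall r, 0 < r <= d -> ((C1 * r `^ a)%:E
      <= mu `[(b - r)%R, (b - r / 2)%R[%classic <= (C2 * r `^ a)%:E)%E) ->
  (inv_moment mu b k b < +oo)%E <-> k%:R < a.
Proof.
move=> d0 C10 C20 shell.
pose D n : set (measurableTypeR R) := `]-oo, (b - d / 2 ^+ n)%R[%classic.
pose I_ n := (\int[mu]_(t in D n) ((b - t)^-1 ^+ k)%:E)%E.
pose q : R := 2^-1 `^ (a - k%:R).
have q0 : 0 < q by rewrite powR_gt0 // invr_gt0.
have r0 n : 0 < d / 2 ^+ n by rewrite divr_gt0 // exprn_gt0.
have rd n : d / 2 ^+ n <= d.
  by rewrite ler_pdivrMr ?exprn_gt0 // ler_peMr ?(ltW d0) // exprn_ege1 // ler1n.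
have rS n : d / 2 ^+ n.+1 = d / 2 ^+ n / 2 by rewrite exprSr invfM mulrA.
have mJ (E : set (measurableTypeR R)) :
    measurable_fun E (fun t : measurableTypeR R => ((b - t)^-1 ^+ k)%:E).
  exact: measurable_EFin_inv_sub_exp.
have J0 t : t < b -> (0 <= ((b - t)^-1 ^+ k)%:E)%E.
  by rewrite lee_fin => tb; rewrite exprn_ge0 // invr_ge0 subr_ge0 ltW.
have rk n : (d / 2 ^+ n)^-1 ^+ k * (d / 2 ^+ n) `^ a = d `^ (a - k%:R) * q ^+ n.
  rewrite /q -powR_halving // powRB; last by rewrite (gt_eqF (r0 n)) implybT.
  by rewrite powR_mulrn ?(ltW (r0 n)) // exprVn mulrC.
have mD n : measurable (D n) by exact: measurable_itv.
have Istep n : exists2 s : \bar R, I_ n.+1 = (I_ n + s)%E &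
    ((C1 * d `^ (a - k%:R) * q ^+ n)%:E <= s
     <= (2 ^+ k * C2 * d `^ (a - k%:R) * q ^+ n)%:E)%E.
  exists (\int[mu]_(t in `[(b - d / 2 ^+ n)%R, (b - d / 2 ^+ n / 2)%R[)
    ((b - t)^-1 ^+ k)%:E)%E.
    have DE : D n.+1 =
        D n `|` `[(b - d / 2 ^+ n)%R, (b - d / 2 ^+ n / 2)%R[%classic.
      rewrite /D rS; apply: itv_bndbnd_setU; first by [].
      by rewrite bnd_simp; have := r0 n; lra.
    rewrite /I_ DE; apply: ge0_integral_setU => //.
    - rewrite -DE => t; rewrite /D /= in_itv /= => tb; apply: J0.
      by have := r0 n.+1; lra.
    - rewrite disj_set2E; apply/eqP/seteqP; split => // t [].
      by rewrite /D /= !in_itv /= => t1 /andP[t2 _]; lra.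
  have := shell_inv_moment k (r0 n) (shell _ _).
  move=> /(_ _); rewrite r0 rd => /(_ isT) /andP[h1 h2].
  apply/andP; split.
    apply: le_trans h1; rewrite -EFinM lee_fin mulrCA rk mulrA //.
  apply: (le_trans h2); rewrite -EFinM lee_fin.
  have -> : (d / 2 ^+ n / 2)^-1 ^+ k = (d / 2 ^+ n)^-1 ^+ k * 2 ^+ k.
    by rewrite (invfM (d / 2 ^+ n)) invrK exprMn.
  rewrite -[leRHS]mulrA -rk.
  move: (_^-1 ^+ k) (2 ^+ k) (_ `^ a) => u v w.
  by rewrite [leRHS](_ : _ = u * v * (C2 * w)) //; ring.
have Icvg : I_ n @[n --> \oo] --> inv_moment mu b k b.
  have DU : `]-oo, b[%classic = \bigcup_n D n.
    apply/seteqP; split => [t|t [n _]]; rewrite /D /= !in_itv /= => tb; last first.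
      by have := r0 n; lra.
    have bt : 0 < b - t by rewrite subr_gt0.
    (* This n is larger than d / (b - t), and n < 2 ^+ n. *)
    exists (Num.Def.trunc (d / (b - t))).+1 => //=; rewrite in_itv /=.
    rewrite ltrBrDr -ltrBrDl ltr_pdivrMr ?exprn_gt0 // -ltr_pdivrMl // mulrC.
    apply: lt_trans (truncnS_gt _) _.
    by rewrite -natrX ltr_nat ltn_expl.
  rewrite /inv_moment DU; apply: ge0_nondecreasing_set_cvg_integral => //.
  - apply/nondecreasing_seqP => n; rewrite /D rS; apply/subsetPset => t /=.
    by rewrite !in_itv /=; have := r0 n; lra.
  - move=> n t; rewrite /D /= in_itv /= => tb; apply: J0.
    by have := r0 n; lra.
split => [Jfin|ka].
  rewrite ltNge; apply/negP => ak.
  have q1 : 1 <= q.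
    rewrite /q -[leLHS](powRr0 2^-1); apply: ger_powR; last by rewrite subr_le0.
    by rewrite invr_gt0 ltr0n invf_le1 // ler1n.
  suff : inv_moment mu b k b = +oo%E by move=> E; rewrite E ltxx in Jfin.
  pose e := C1 * d `^ (a - k%:R).
  have e0 : 0 < e by rewrite mulr_gt0 // powR_gt0.
  have Ilow n : ((n%:R * e)%:E <= I_ n)%E.
    elim: n => [|n IH].
      rewrite mul0r; apply: integral_ge0 => t; rewrite /D /= in_itv /= => tb.
      by apply: J0; have := r0 0%N; lra.
    have [s -> /andP[s1 _]] := Istep n.
    rewrite -natr1 mulrDl mul1r EFinD; apply: leeD => //.
    apply: le_trans s1; rewrite lee_fin -/e ler_peMr ?(ltW e0) //.
    by rewrite exprn_ege1.
  apply/eqyP => A A0.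
  rewrite -(cvg_lim _ Icvg) //; apply: lime_ge; first exact: cvgP Icvg.
  exists (Num.Def.trunc (A / e)).+1 => // n /= nA.
  apply: le_trans (Ilow n); rewrite lee_fin -ler_pdivrMr //.
  by apply: le_trans (ltW (truncnS_gt _)) _; rewrite ler_nat.
have q1 : q < 1.
  apply: (@lt_le_trans _ _ (1 `^ (a - k%:R))); last by rewrite powR1.
  apply: gt0_ltr_powR; rewrite ?subr_gt0 ?nnegrE ?invr_ge0 //.
  by rewrite invf_lt1 // ltr1n.
(* K (1 - q ^+ n) is the sum of the first n upper bounds on the shells, and A
   bounds the integral over ]-oo, b - d[. *)
pose K := 2 ^+ k * C2 * d `^ (a - k%:R) / (1 - q).
pose A := d^-1 ^+ k.
have Iup n : (I_ n <= (A + K * (1 - q ^+ n))%:E)%E.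
  elim: n => [|n IH].
    rewrite expr0 subrr mulr0 addr0 /I_.
    apply: (@le_trans _ _ (\int[mu]_(t in D 0%N) (cst A%:E t))%E).
      apply: ge0_le_integral => //.
      - move=> t; rewrite /D /= in_itv /= => tb; apply: J0.
        by have := r0 0%N; lra.
      - move=> t; rewrite /D /= in_itv /= expr0 divr1 lee_fin => tb.
        by apply: ler_invX; lra.
    rewrite integral_cst //= -[leRHS]mule1 lee_wpmul2l ?probability_le1 //.
    by rewrite lee_fin exprn_ge0 // invr_ge0 ltW.
  have [s -> /andP[_ s2]] := Istep n.
  apply: le_trans (leeD IH s2) _; rewrite -EFinD lee_fin.
  rewrite le_eqVlt; apply/orP; left; apply/eqP.
  rewrite exprSr /K; field.
  by rewrite subr_eq0 gt_eqF.
apply: (@le_lt_trans _ _ (A + K)%:E); last exact: ltry.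
rewrite -(cvg_lim _ Icvg) //; apply: lime_le; first exact: cvgP Icvg.
apply: nearW => n; apply: le_trans (Iup n) _.
rewrite lee_fin lerD2l ler_piMr ?gerBl ?exprn_ge0 ?ltW //.
by rewrite /K divr_gt0 ?subr_gt0 // !mulr_gt0 ?exprn_gt0 ?powR_gt0.
Qed.

(** * Behaviour of the Cauchy transform at the edge *)

Theorem proposition2p4 (R : realType)
    (mu : probability (measurableTypeR R) R)
    (mu_compact : compact (measure_support mu))
    (b : R) (b_sup : b = sup (measure_support mu))
    (f : R -> R) (mu_f : is_density mu f)
    (c alpha : R) (c_gt0 : 0 < c) (alpha_gtN1 : -1 < alpha)
    (f_decay : equiv_at_left b f (fun t => c * (b - t) `^ alpha)) :
  let G := cauchy_transform mu in
  [/\ forall z, b < z -> derivable G z 1,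
      has_right_lim G b,
      has_right_lim (derive1 G) b &
      [/\ (right_lim G b < +oo)%E <-> 0 < alpha,
          right_lim (derive1 G) b = -oo%E <-> alpha <= 1 &
          alpha = 2^-1 ->
            (right_lim G b < +oo)%E /\ right_lim (derive1 G) b = -oo%E]].
Proof.
move=> G.
have mub : mu `[b, +oo[%classic = 0%E.
  exact: measure_ge_sup_support b_sup (density_measure_set1 b mu_f).
have dG z (bz : b < z) := is_derive_cauchy_transform mub bz.
have GE z : b < z -> (G z)%:E = inv_moment mu b 1 z.
  by move=> bz; rewrite /G (cauchy_transform_lt _ mub) -EFin_Rintegral_inv_sub_exp.
have G'E z : b < z -> (derive1 G z)%:E = (- inv_moment mu b 2 z)%E.
  move=> bz; have [_ G'z] := dG z bz.
  by rewrite derive1E G'z EFinN EFin_Rintegral_inv_sub_exp.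
have cG := cvg_at_right_eq GE (@cvg_inv_moment _ mu b 1).
have cG' : (derive1 G z)%:E @[z --> b^'+] --> (- inv_moment mu b 2 b)%E.
  by apply: cvg_at_right_eq G'E _; apply: cvgeN; exact: cvg_inv_moment.
have [d [C1 [C2 [d0 C10 C20 shell]]]] := density_power_shell mu_f c_gt0 f_decay.
have J1 : (inv_moment mu b 1 b < +oo)%E <-> 0 < alpha.
  by rewrite (inv_moment_lty 1 d0 C10 C20 shell) -ltrBlDr subrr.
have J2 : (- inv_moment mu b 2 b)%E = -oo%E <-> alpha <= 1.
  have := inv_moment_lty 2 d0 C10 C20 shell.
  rewrite -ltrBlDr ltey => J2; split.
    move=> /eqP; rewrite eqe_oppLR /= => /eqP Joo; rewrite leNgt; apply/negP => a1.
    by have /J2 : 2%:R - 1 < alpha; [lra|rewrite Joo eqxx].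
  move=> a1; apply/eqP; rewrite eqe_oppLR /=; apply/negPn/negP => /J2; lra.
have LG : right_lim G b = inv_moment mu b 1 b.
  by rewrite /right_lim (cvg_lim _ cG).
have LG' : right_lim (derive1 G) b = (- inv_moment mu b 2 b)%E.
  by rewrite /right_lim (cvg_lim _ cG').
split.
- by move=> z /dG [].
- by apply/cvg_ex; exists (inv_moment mu b 1 b).
- by apply/cvg_ex; exists (- inv_moment mu b 2 b)%E.
rewrite LG LG'; split => // a12.
by split; [apply/J1|apply/J2]; rewrite a12; lra.
Qed.
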